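(* $t(K(10,4))=\frac{3}{2}$. Moreover, if $S$ is a vertex cut of $K(10,4)$ such that $\frac{|S|}{c(K(10,4)\setminus S)} = \frac{3}{2}$, then $S$ is the complement of a maximum independent set of $K(10,4)$.
   Context: The Kneser graph $K(n,k)$ has as vertices the $k$-element subsets of $[n]=\{1,\dots,n\}$, two vertices being adjacent iff they are disjoint. A vertex cut is a set $S$ of vertices whose removal disconnects the graph; $c(G\setminus S)$ is the number of connected components after deleting $S$; the toughness is $t(G)=\min_S |S|/c(G\setminus S)$ over vertex cuts $S$. *)

(* Defs.v *)
From mathcomp Require Import all_boot all_order all_algebra.
Set Implicit Arguments. Unset Strict Implicit. Unset Printing Implicit Defensive.
Import Order.TTheory GRing.Theory Num.Theory.

Definition kvert (n k : nat) := {A : {set 'I_n} | #|A| == k}.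

Definition kneser_adj (n k : nat) : rel (kvert n k) :=
  fun A B => [disjoint val A & val B].

Section Graph.
Variables (T : finType) (e : rel T).

Definition del_rel (S : {set T}) : rel T :=
  fun x y => [&& x \notin S, y \notin S & e x y].

Definition comp_of (S : {set T}) (x : T) : {set T} :=
  [set y in ~: S | connect (del_rel S) x y].

Definition ncomp (S : {set T}) : nat := #|[set comp_of S x | x in ~: S]|.

Definition vertex_cut (S : {set T}) : bool := 1 < ncomp S.

Definition cut_ratio (S : {set T}) : rat := (#|S|%:R / (ncomp S)%:R)%R.

Definition is_toughness (t : rat) : Prop :=
  (exists2 S, vertex_cut S & cut_ratio S = t) /\
  (forall S, vertex_cut S -> (t <= cut_ratio S)%R).

Definition independent (I : {set T}) : bool :=
  [forall x in I, forall y in I, ~~ e x y].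

Definition maximum_independent (I : {set T}) : Prop :=
  independent I /\ forall J : {set T}, independent J -> #|J| <= #|I|.

End Graph.

(* Main.v *)
(** Spectral proof.  The adjacency matrix A of K(10,4) has eigenvalues
    15, -10, 6, -3, 1, so A + 10 - (5/42) J and 6 + (3/70) J - A are positive
    semidefinite.  Let a component of the complement of a cut S have m vertices
    and d ordered adjacent pairs.  Testing the first form on the vector equal to
    m / (d + 10 m) on each component gives sum m^2 / (d + 10 m) <= 42/5, a
    refinement of the ratio bound.  Each term is at least (3 + 2 m) / 50, with
    equality only when m = 1: for small m because d <= m (m - 1), for larger m by
    the second form, as m <= 194 whenever there is another component.  With c
    components this yields 3 c + 2 (210 - |S|) <= 420, that is 3 c <= 2 |S|, and
    equality forces all components to be singletons, hence c = 84, the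
    independence number. *)
Require Import Defs.
From mathcomp Require Import all_boot all_order all_algebra.
From mathcomp Require Import zify ring lra.
Set Implicit Arguments. Unset Strict Implicit. Unset Printing Implicit Defensive.
Import Order.TTheory GRing.Theory Num.Theory.

(** * Counting subsets by the size of an intersection *)

(** Each such set splits uniquely into its parts inside and outside [B], so union is a bijection
    from pairs of draws from [D :&: B] and [D :\: B]. *)
Lemma card_draws_meet (T : finType) (B D : {set T}) (k c : nat) : c <= k ->
  #|[set C : {set T} | [&& C \subset D, #|C| == k & #|C :&: B| == c]]| =
  'C(#|D :&: B|, c) * 'C(#|D :\: B|, k - c).
Proof.
move=> lck; rewrite -!cards_draws -cardsX.
have meetE (X Y : {set T}) : X \subset D :&: B -> Y \subset D :\: B ->
    ((X :|: Y) :&: B = X) * ((X :|: Y) :\: B = Y).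
  rewrite !subsetI setDE subsetI => /andP[_ XB] /andP[_ YB].
  rewrite setIUl (setIidPl XB) setDUl.
  move: XB; rewrite -setD_eq0 => /eqP ->.
  have -> : Y :\: B = Y by rewrite setDE; apply/setIidPl.
  move: YB; rewrite -disjoints_subset -setI_eq0 => /eqP ->.
  by rewrite setU0 set0U.
rewrite -(card_in_imset (f := fun p : {set T} * {set T} => p.1 :|: p.2)); last first.
  move=> [X Y] [X' Y']; rewrite !inE /= => /andP[/andP[XD _] /andP[YD _]].
  move=> /andP[/andP[XD' _] /andP[YD' _]] eqU.
  have [EX EY] := meetE X Y XD YD; have [EX' EY'] := meetE X' Y' XD' YD'.
  by congr pair; [rewrite -EX eqU | rewrite -EY eqU].
congr #|pred_of_set _|; apply/setP=> C; rewrite !inE.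
apply/and3P/imsetP => [[CD /eqP Ck /eqP Cc] | [[X Y]]]; last first.
  rewrite !inE /= => /andP[/andP[XD /eqP Xc] /andP[YD /eqP Yk]] ->.
  have XY0 : X :&: Y = set0.
    apply/eqP; rewrite setI_eq0; apply: disjointWl XD _; apply: disjointWr YD _.
    by rewrite -setI_eq0; apply/eqP/setP => x; rewrite !inE; case: (x \in B); rewrite !andbF.
  rewrite meetE // Xc eqxx cardsU XY0 cards0 Xc Yk subn0 subnKC // eqxx; split=> //.
  by rewrite subUset (subset_trans XD) ?subsetIl // (subset_trans YD) ?subsetDl.
exists (C :&: B, C :\: B); rewrite ?setID // !inE /= setSI // setSD // Cc.
by rewrite cardsD Cc Ck !eqxx.
Qed.

Lemma card_kvert (n k : nat) : #|{: kvert n k}| = 'C(n, k).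
Proof. by rewrite card_sig -cardsE card_draws card_ord. Qed.

Lemma card_kvert_set (n k : nat) (P : pred {set 'I_n}) :
  #|[set B : kvert n k | P (val B)]| = #|[set C : {set 'I_n} | P C & #|C| == k]|.
Proof.
rewrite -!sum1_card.
rewrite [RHS](eq_bigl (fun C : {set 'I_n} => (C \in [pred D : {set 'I_n} | #|D| == k]) && P C)).
  by rewrite (big_sub_cond [pred C : {set 'I_n} | #|C| == k]); apply: eq_bigl=> B; rewrite inE.
by move=> C; rewrite !inE andbC.
Qed.

(** * The adjacency operator on intersection kernels *)

(* If a kernel depends on two vertices only through the size i of their
   intersection, so does its product with the adjacency matrix. *)
Definition walk_kernel (n k : nat) (g : nat -> nat) (i : nat) : nat :=
  sumn [seq g c * ('C(k - i, c) * 'C(n + i - k.*2, k - c)) | c <- iota 0 k.+1].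

(** Neighbours [B] of [A] are the [k]-subsets of [~: val A]; grouping them by [c], the size of their
    meet with [C], gives the binomials. With [i] the size of [A :&: C], that complement has [k - i]
    points in [C] and [n + i - 2k] outside. *)
Lemma walk_kernelP (n k : nat) (g : nat -> nat) (A C : kvert n k) : k.*2 <= n ->
  \sum_(B | kneser_adj A B) g #|val B :&: val C| =
  walk_kernel n k g #|val A :&: val C|.
Proof.
move=> le2kn.
have szA := eqP (valP A); have szC := eqP (valP C).
have meetk (B : kvert n k) : #|val B :&: val C| < k.+1.
  by rewrite ltnS -[X in _ <= X](eqP (valP B)) subset_leq_card ?subsetIl.
rewrite (partition_big (fun B => Ordinal (meetk B)) predT) //=.
rewrite /walk_kernel sumnE big_map -[iota 0 k.+1]/(index_iota 0 k.+1) big_mkord.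
apply: eq_bigr => c _.
rewrite (eq_bigr (fun=> g c)); last by move=> B /andP[_ /eqP <-].
rewrite sum_nat_const mulnC; congr (_ * _).
have -> : k - #|val A :&: val C| = #|~: val A :&: val C|.
  have := cardsID (val A) (val C).
  by rewrite szC setDE [val C :&: _]setIC [val C :&: ~: _]setIC => ?; lia.
have -> : n + #|val A :&: val C| - k.*2 = #|~: val A :\: val C|.
  rewrite setDE -setCU -addnn.
  have := cardsC (val A :|: val C); rewrite cardsU szA szC card_ord.
  by have := meetk A; lia.
rewrite -card_draws_meet; last by rewrite -ltnS.
rewrite -cardsE.
have := @card_kvert_set n k (fun B => (B \subset ~: val A) && (#|B :&: val C| == c)).
rewrite (_ : [set B : kvert n k | _] = [set x | kneser_adj A x && (Ordinal (meetk x) == c)]).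
  move=> ->; congr #|pred_of_set _|; apply/setP => B; rewrite !inE.
  by rewrite -andbA [(#|_| == k) && _]andbC.
by apply/setP => B; rewrite !inE /kneser_adj disjoint_sym disjoints_subset.
Qed.

Local Open Scope ring_scope.

Definition nbr_sum (n k : nat) (x : kvert n k -> rat) (A : kvert n k) : rat :=
  \sum_(B | kneser_adj A B) x B.

Lemma nbr_sum_kernel (n k : nat) (g : nat -> nat) (x : kvert n k -> rat) (A : kvert n k) :
  (k.*2 <= n)%N ->
  nbr_sum (fun B => \sum_C (g #|val B :&: val C|)%:R * x C) A =
  \sum_C (walk_kernel n k g #|val A :&: val C|)%:R * x C.
Proof.
move=> le2kn; rewrite /nbr_sum exchange_big /=; apply: eq_bigr => C _.
by rewrite -mulr_suml -natr_sum walk_kernelP.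
Qed.

Lemma eq_nbr_sum (n k : nat) (x y : kvert n k -> rat) : x =1 y -> nbr_sum x =1 nbr_sum y.
Proof. by move=> xy A; apply: eq_bigr => B _; apply: xy. Qed.

(** Powers of the adjacency matrix thus become computable functions of the intersection size. The
    iteration starts from the identity matrix, whose kernel is [i == k] because two [k]-sets meeting
    in [k] points coincide. *)
Lemma iter_nbr_sum (n k j : nat) (x : kvert n k -> rat) (A : kvert n k) :
  (k.*2 <= n)%N ->
  iter j (@nbr_sum n k) x A =
  \sum_C (iter j (walk_kernel n k) (fun i => i == k) #|val A :&: val C|)%:R * x C.
Proof.
move=> le2kn; elim: j A => [|j IHj] A /=; last first.
  by rewrite -nbr_sum_kernel //; apply: eq_nbr_sum.
rewrite (bigD1 A) //= setIid (eqP (valP A)) eqxx mul1r big1 ?addr0 // => C neqCA.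
have [eqk|] := eqVneq #|val A :&: val C| k; last by rewrite mul0r.
case/eqP: neqCA; apply/val_inj/eqP.
have sub (X Y : {set 'I_n}) : #|X| = k -> #|Y :&: X| = k -> X \subset Y.
  by move=> Xk YXk; apply/setIidPr/eqP; rewrite eqEcard subsetIr Xk YXk /=.
rewrite eqEsubset !sub ?(eqP (valP C)) ?(eqP (valP A)) //.
by rewrite setIC.
Qed.

Lemma sum_mul_nbr_sum (n k : nat) (x y : kvert n k -> rat) :
  \sum_A x A * nbr_sum y A = \sum_A nbr_sum x A * y A.
Proof.
under eq_bigr do rewrite mulr_sumr big_mkcond.
rewrite exchange_big /=; apply: eq_bigr => B _.
rewrite mulr_suml [RHS]big_mkcond; apply: eq_bigr => A _.
by rewrite /kneser_adj disjoint_sym.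
Qed.

(** * Degree, minimal polynomial and semidefinite forms of K(10,4) *)

Lemma degree_kneser104 (A : kvert 10 4) : #|[set B | kneser_adj A B]| = 15%N.
Proof.
rewrite -sum1_card; under eq_bigl do rewrite inE.
by rewrite (@walk_kernelP 10 4 (fun=> 1%N) A A) // setIid (eqP (valP A)).
Qed.

Lemma sum_nbr_sum (x : kvert 10 4 -> rat) : \sum_A nbr_sum x A = 15 * \sum_A x A.
Proof.
under eq_bigr do rewrite -[nbr_sum x _]mul1r.
rewrite sum_mul_nbr_sum mulr_sumr; apply: eq_bigr => A _; congr (_ * _).
by rewrite /nbr_sum sumr_const -cardsE degree_kneser104.
Qed.

(* The eigenvalues of the adjacency operator are 15, -10, 6, -3, 1, so the
   monic polynomial with the last four roots maps it to a multiple of J;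
   270 is its value at 15 divided by 210. *)
Lemma nbr_sum_min_poly (x : kvert 10 4 -> rat) (A : kvert 10 4) :
  iter 4 (@nbr_sum 10 4) x A + 6 * iter 3 (@nbr_sum 10 4) x A
    - 55 * iter 2 (@nbr_sum 10 4) x A - 132 * iter 1 (@nbr_sum 10 4) x A + 180 * x A
  = 270 * \sum_B x B.
Proof.
(* The identity is computed on the five intersection sizes, over [nat] with the negative terms moved
   across; the existential keeps the kernel opaque afterwards. *)
have [g [gE xE]] : exists g : nat -> nat -> nat,
    (forall i, (i < 5)%N ->
      (g 4 i + 6 * g 3 i + 180 * g 0 i = 55 * g 2 i + 132 * g 1 i + 270)%N) /\
    forall j, iter j (@nbr_sum 10 4) x A = \sum_C (g j #|val A :&: val C|)%:R * x C.
  exists (fun j => iter j (walk_kernel 10 4) (fun i => i == 4)).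
  split=> [|j]; last exact: iter_nbr_sum.
  by case=> [|[|[|[|[|i]]]]] // _; vm_compute.
rewrite (xE 4) (xE 3) (xE 2) (xE 1) -[x A]/(iter 0 (@nbr_sum 10 4) x A) (xE 0).
have linE (a b c d : rat) (F4 F3 F2 F1 F0 : kvert 10 4 -> rat) :
    \sum_C F4 C + a * \sum_C F3 C - b * \sum_C F2 C - c * \sum_C F1 C + d * \sum_C F0 C
    = \sum_C (F4 C + a * F3 C - b * F2 C - c * F1 C + d * F0 C).
  by rewrite !mulr_sumr -!sumrN -!big_split.
rewrite linE mulr_sumr; apply: eq_bigr => C _.
have : (#|val A :&: val C| < 5)%N.
  by rewrite ltnS -[X in (_ <= X)%N](eqP (valP A)) subset_leq_card ?subsetIl.
move: #|_| => i /gE /(congr1 (fun m => m%:R : rat)) e.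
have -> : (g 4 i)%:R = 55 * (g 2 i)%:R + 132 * (g 1 i)%:R + 270 - 6 * (g 3 i)%:R
    - 180 * (g 0 i)%:R :> rat by lra.
by ring.
Qed.

Lemma sum_sqr_comb (T : finType) (b c d : rat) (z y x : T -> rat) :
  \sum_A (z A + b * y A + c * x A + d) ^+ 2 =
  \sum_A z A * z A + b ^+ 2 * \sum_A y A * y A + c ^+ 2 * \sum_A x A * x A
  + 2 * b * \sum_A z A * y A + 2 * c * \sum_A z A * x A + 2 * b * c * \sum_A y A * x A
  + 2 * d * \sum_A z A + 2 * b * d * \sum_A y A + 2 * c * d * \sum_A x A
  + #|T|%:R * d ^+ 2.
Proof.
have -> : #|T|%:R * d ^+ 2 = \sum_(A : T) d ^+ 2 by rewrite sumr_const mulr_natl.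
by rewrite !mulr_sumr -!big_split /=; apply: eq_bigr => A _; ring.
Qed.

(** These are the two semidefinite forms evaluated at [x], each certified by sums of squares. *)
Lemma kneser104_form_bounds (x : kvert 10 4 -> rat) :
  let s := \sum_A x A in
  let q := \sum_A x A * x A in
  let a := \sum_A x A * nbr_sum x A in
  5 * s ^+ 2 <= 42 * (a + 10 * q) /\ 70 * a <= 420 * q + 3 * s ^+ 2.
Proof.
move=> s q a.
pose x1 := nbr_sum x; pose x2 := nbr_sum x1; pose x3 := nbr_sum x2; pose x4 := nbr_sum x3.
(* Self-adjointness turns every inner product of iterates into a moment of [x] with some [xj]; the
   minimal polynomial then eliminates the fourth moment. *)
have e11 : \sum_A x1 A * x1 A = \sum_A x A * x2 A by rewrite -sum_mul_nbr_sum.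
have e21 : \sum_A x2 A * x1 A = \sum_A x A * x3 A.
  by rewrite [RHS]sum_mul_nbr_sum; apply: eq_bigr => A _; rewrite mulrC.
have e20 : \sum_A x2 A * x A = \sum_A x A * x2 A by apply: eq_bigr => A _; rewrite mulrC.
have e10 : \sum_A x1 A * x A = a by apply: eq_bigr => A _; rewrite mulrC.
have e22 : \sum_A x2 A * x2 A = \sum_A x A * x4 A.
  by rewrite -!sum_mul_nbr_sum.
have s1 : \sum_A x1 A = 15 * s by exact: sum_nbr_sum.
have s2 : \sum_A x2 A = 225 * s by rewrite sum_nbr_sum s1; ring.
have e4 : \sum_A x A * x4 A = 55 * \sum_A x A * x2 A + 132 * a + 270 * s ^+ 2
    - 6 * \sum_A x A * x3 A - 180 * q.
  rewrite (eq_bigr (fun A => 55 * (x A * x2 A) + 132 * (x A * x1 A) + 270 * s * x A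
    - 6 * (x A * x3 A) - 180 * (x A * x A))); last first.
    by move=> A _; have := nbr_sum_min_poly x A; rewrite /= -/x1 -/x2 -/x3 -/x4 -/s; nra.
  have linE (a1 a2 a3 a4 a5 : rat) (F1 F2 F3 F4 F5 : kvert 10 4 -> rat) :
      \sum_A (a1 * F1 A + a2 * F2 A + a3 * F3 A - a4 * F4 A - a5 * F5 A) =
      a1 * \sum_A F1 A + a2 * \sum_A F2 A + a3 * \sum_A F3 A - a4 * \sum_A F4 A
      - a5 * \sum_A F5 A.
    by rewrite !mulr_sumr -!sumrN -!big_split.
  by rewrite linE -/a -/q -/s expr2 mulrA.
have card210 : #|{: kvert 10 4}|%:R = 210 :> rat by rewrite card_kvert.
have sqr_sum_ge0 b c d y z : 0 <= \sum_(A : kvert 10 4) (z A + b * y A + c * x A + d) ^+ 2.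
  by apply: sumr_ge0 => A _; apply: sqr_ge0.
(* 1232 (A + 10 - 5/42 J) = ((A + 10)(A - 7) - 20/21 J)^2 + 76 (A + 10 - 5/42 J)^2 and
   720 (6 + 3/70 J - A) = ((A - 6)(A + 9) - 36/35 J)^2 + 44 (A - 6 - 3/70 J)^2. *)
have := sqr_sum_ge0 0 10 (- (5 / 42) * s) x x1.
have := sqr_sum_ge0 3 (-70) (- (20 / 21) * s) x1 x2.
have := sqr_sum_ge0 0 (-6) (- (3 / 70) * s) x x1.
have := sqr_sum_ge0 3 (-54) (- (36 / 35) * s) x1 x2.
rewrite !sum_sqr_comb card210 e22 e4 e21 e20 e11 e10 s1 s2 -/s -/q.
by split; lra.
Qed.

(** * Components left by a vertex set *)

Definition components (T : finType) (e : rel T) (S : {set T}) : {set {set T}} :=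
  [set comp_of e S x | x in ~: S].

Lemma comp_refl (T : finType) (e : rel T) (S : {set T}) (x : T) :
  x \notin S -> x \in comp_of e S x.
Proof. by move=> xS; rewrite !inE xS connect0. Qed.

Lemma partition_components (T : finType) (e : rel T) (S : {set T}) :
  symmetric e -> partition (components e S) (~: S).
Proof.
move=> sym_e; apply: (@equivalence_partitionP _ (connect (del_rel e S))).
have sym_c : connect_sym (del_rel e S).
  by apply: sym_connect_sym => x y; rewrite /del_rel sym_e andbCA.
move=> x y z _ _ _; split; first exact: connect0.
by move=> /(same_connect sym_c).
Qed.

Lemma component_closed (T : finType) (e : rel T) (S C : {set T}) (u v : T) :
  C \in components e S -> u \in C -> e u v -> v \notin S -> v \in C.
Proof.
case/imsetP => x _ ->; rewrite !inE => /andP[uS xu] euv vS; rewrite vS.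
by apply: connect_trans xu (connect1 _); rewrite /del_rel uS vS.
Qed.

(** No edge joins two vertices of [I], so the components are the singletons. *)
Lemma ncomp_independent (T : finType) (e : rel T) (I : {set T}) :
  independent e I -> ncomp e (~: I) = #|I|.
Proof.
move=> /forall_inP indI; rewrite /ncomp setCK -[RHS](card_imset _ (@set1_inj T)).
congr #|pred_of_set _|; apply: eq_in_imset => x xI; apply/setP => y.
rewrite !inE negbK; apply/andP/eqP => [[yI /connectP[[|z p] /=]]|->]; last first.
- by rewrite xI connect0.
- rewrite /del_rel !inE !negbK => /andP[/and3P[_ zI exz] _].
  by have /forall_inP/(_ z zI) := indI x xI; rewrite exz.
by move=> _ ->.
Qed.

Lemma kneser_sym (n k : nat) : symmetric (@kneser_adj n k).
Proof. by move=> A B; rewrite /kneser_adj disjoint_sym. Qed.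

Lemma kneser_irr (n k : nat) (A : kvert n k) : (0 < k)%N -> kneser_adj A A = false.
Proof.
move=> k_gt0; rewrite /kneser_adj -setI_eq0 setIid -cards_eq0 (eqP (valP A)).
by rewrite gtn_eqF.
Qed.

(** * Edges inside a vertex set and the independence bound *)

Definition inner_degree (T : finType) (e : rel T) (C : {set T}) : nat :=
  \sum_(v in C) #|[set u in C | e v u]|.

Lemma inner_degree_le (T : finType) (e : rel T) (C : {set T}) :
  irreflexive e -> (inner_degree e C <= #|C| * #|C|.-1)%N.
Proof.
move=> irr_e; rewrite -sum_nat_const; apply: leq_sum => v vC.
rewrite (cardsD1 v C) vC /=; apply/subset_leq_card/subsetP => u.
by rewrite !inE => /andP[-> evu]; rewrite andbT; apply: contraTneq evu => ->; rewrite irr_e.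
Qed.

Definition indic (T : finType) (C : {set T}) (v : T) : rat := (v \in C)%:R.

Lemma sum_indic_mul (T : finType) (C : {set T}) (F : T -> rat) :
  \sum_v indic C v * F v = \sum_(v in C) F v.
Proof.
by rewrite [RHS]big_mkcond; apply: eq_bigr => v _; rewrite /indic; case: (v \in C);
  rewrite ?mul1r ?mul0r.
Qed.

Lemma sum_indic (T : finType) (C : {set T}) : \sum_v indic C v = #|C|%:R.
Proof. by under eq_bigr do rewrite -[indic _ _]mulr1; rewrite sum_indic_mul sumr_const. Qed.

Lemma nbr_sum_indic (n k : nat) (C : {set kvert n k}) (v : kvert n k) :
  nbr_sum (indic C) v = #|[set u in C | kneser_adj v u]|%:R.
Proof.
rewrite -sum1_card natr_sum /nbr_sum big_mkcond [RHS]big_mkcond.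
by apply: eq_bigr => u _; rewrite inE andbC /indic; case: kneser_adj => //=; case: (u \in C).
Qed.

(** At the indicator vector of [C], the sum and the square norm are both [m], and the adjacency form
    is [d]. *)
Lemma kneser104_indic_bounds (C : {set kvert 10 4}) :
  let m : rat := #|C|%:R in
  let d : rat := (inner_degree (@kneser_adj 10 4) C)%:R in
  5 * m ^+ 2 <= 42 * (d + 10 * m) /\ 70 * d <= 420 * m + 3 * m ^+ 2.
Proof.
have := kneser104_form_bounds (indic C); rewrite /= !sum_indic_mul sum_indic.
have -> : \sum_(v in C) indic C v = #|C|%:R.
  by rewrite -sumr_const; apply: eq_bigr => v vC; rewrite /indic vC.
by under eq_bigr do rewrite nbr_sum_indic; rewrite -natr_sum.
Qed.

(** Hoffman's ratio bound: with [d = 0] the first form gives [5 m^2 <= 420 m]. *)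
Lemma kneser104_independent_le (I : {set kvert 10 4}) :
  independent (@kneser_adj 10 4) I -> (#|I| <= 84)%N.
Proof.
move=> /forall_inP indI; have [+ _] := kneser104_indic_bounds I.
have -> : inner_degree (@kneser_adj 10 4) I = 0%N.
  apply: big1 => v vI; apply/eqP; rewrite cards_eq0; apply/eqP/setP => u; rewrite !inE.
  by apply/negbTE/negP => /andP[uI euv]; have /forall_inP/(_ u uI) := indI v vI; rewrite euv.
rewrite -(ler_nat rat); have : 0 <= #|I|%:R :> rat by [].
by move: (#|I|%:R : rat) => m m0; nra.
Qed.

(** * Size and weight of the components of a cut *)

(** A vertex of another component and its 15 neighbours all avoid [C], and 210 - 16 = 194. *)
Lemma cut_component_le (S C : {set kvert 10 4}) :
  vertex_cut (@kneser_adj 10 4) S -> C \in components (@kneser_adj 10 4) S ->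
  (0 < #|C| <= 194)%N.
Proof.
set e := @kneser_adj 10 4 => cutS CP.
have /and3P[/eqP covP trivP nP] := partition_components S (@kneser_sym 10 4).
apply/andP; split; first by rewrite card_gt0; apply: contraNneq nP => <-.
have [C' C'P neqC] : exists2 C', C' \in components e S & C' != C.
  have : (0 < #|components e S :\ C|)%N.
    by move: cutS; rewrite /vertex_cut /ncomp -/(components e S) (cardsD1 C) CP.
  by case/card_gt0P => C'; rewrite !inE => /andP[? ?]; exists C'.
have dis : [disjoint C & C'] by move/trivIsetP: trivP; apply=> //; rewrite eq_sym.
have /set0Pn[v vC'] : C' != set0 by apply: contraNneq nP => <-.
have sub : v |: [set u | e v u] \subset ~: C.
  apply/subsetP => u; rewrite !inE => /orP[/eqP ->|evu].
    by rewrite (disjointFl dis).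
  apply/negP => uC; have: v \in C.
    apply: (component_closed CP uC); first by rewrite /e kneser_sym.
    by move: (vC'); case/imsetP: C'P => w _ ->; rewrite !inE => /andP[].
  by rewrite (disjointFl dis).
have := subset_leq_card sub; rewrite cardsU1 inE /e kneser_irr // degree_kneser104.
have := cardsC C; rewrite card_kvert (_ : 'C(10, 4) = 210)%N //.
by move: #|C| #|~: C| => p q; clear; lia.
Qed.

(* The bound d <= m (m - 1) is the sharper one for small components, the
   spectral one for large components. *)
Lemma component_weight_lt (m d : rat) : 2 <= m -> m <= 13 \/ 14 <= m <= 194 ->
  d <= m * (m - 1) -> 70 * d <= 420 * m + 3 * m ^+ 2 ->
  (3 + 2 * m) * (d + 10 * m) < 50 * m ^+ 2.
Proof.
move=> m2 mrange dle1 dle2; case: mrange => [m13|/andP[m14 m194]].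
  have h1 : 0 <= (3 + 2 * m) * (m * (m - 1) - d) by apply: mulr_ge0; lra.
  (* At [d = m (m - 1)] this is exactly the right side minus the left side. *)
  have h2 : 0 < m * (m - 1) * (27 - 2 * m).
    by do 2?[apply: mulr_gt0]; lra.
  by lra.
have h1 : 0 <= (3 + 2 * m) * (420 * m + 3 * m ^+ 2 - 70 * d) by apply: mulr_ge0; lra.
(* With [d] at the spectral bound, 70 times the gap is
   [6 m (m - 14) (194 - m) + 3 m^2 + 12936 m]. *)
have h2 : 0 <= m * ((m - 14) * (194 - m)) by do 2?[apply: mulr_ge0]; lra.
have h3 : 0 < m * m by apply: mulr_gt0; lra.
by lra.
Qed.

(** For a singleton [d = 0] and both sides are 1/10; larger components are strict. The [?= iff] form
    lets the equality case be summed. *)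
Lemma component_weight (S C : {set kvert 10 4}) :
  vertex_cut (@kneser_adj 10 4) S -> C \in components (@kneser_adj 10 4) S ->
  let m : rat := #|C|%:R in
  let d : rat := (inner_degree (@kneser_adj 10 4) C)%:R in
  (3 + 2 * m) / 50 <= m ^+ 2 / (d + 10 * m) ?= iff (#|C| == 1%N).
Proof.
move=> cutS CP m d; have /andP[C_gt0 C_le] := cut_component_le cutS CP.
have := inner_degree_le C (fun A => @kneser_irr 10 4 A isT); have [_] := kneser104_indic_bounds C.
rewrite -/m -/d => dle1 dle2.
have d0 : 0 <= d by [].
have m1 : 1 <= m by rewrite ler1n.
have dle2r : d <= m * (m - 1).
  by rewrite -(ler_nat rat) in dle2; move: dle2; rewrite natrM -subn1 natrB.
have D0 : 0 < d + 10 * m by lra.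
have [C1|C1] := eqVneq #|C| 1%N.
  have em : m = 1 by rewrite /m C1.
  have ed : d = 0 by move: dle2r; rewrite em; lra.
  have -> : m ^+ 2 / (d + 10 * m) = (3 + 2 * m) / 50 by rewrite em ed; field.
  exact/leif_refl.
suff lt : (3 + 2 * m) / 50 < m ^+ 2 / (d + 10 * m) by split; [exact: ltW | rewrite lt_eqF].
rewrite (ltr_pdivlMr _ _ D0).
suff : (3 + 2 * m) * (d + 10 * m) < 50 * m ^+ 2 by lra.
have m2 : 2 <= m by rewrite ler_nat ltn_neqAle eq_sym C1.
apply: component_weight_lt m2 _ dle2r dle1.
(* Sizes are integers, so nothing is lost between 13 and 14. *)
by have [C13|C14] := leqP #|C| 13; [left|right; apply/andP; split]; rewrite ler_nat.
Qed.

(** Writing [t] for the sum, the first form at a suitable vector reads [5 t^2 <= 42 t]. *)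
Lemma sum_component_weight (S : {set kvert 10 4}) :
  vertex_cut (@kneser_adj 10 4) S ->
  \sum_(C in components (@kneser_adj 10 4) S)
    #|C|%:R ^+ 2 / ((inner_degree (@kneser_adj 10 4) C)%:R + 10 * #|C|%:R) <= 42 / 5 :> rat.
Proof.
set e := @kneser_adj 10 4; set P := components e S => cutS.
have parP := partition_components S (@kneser_sym 10 4).
have /and3P[/eqP covP trivP _] := parP.
(* The weight m / (d + 10 m) on each component makes the quadratic form and
   the sum of x coincide. *)
pose D (C : {set kvert 10 4}) : rat := (inner_degree e C)%:R + 10 * #|C|%:R.
pose w (C : {set kvert 10 4}) : rat := #|C|%:R / D C.
pose x (v : kvert 10 4) : rat := if v \in ~: S then w (pblock P v) else 0.
have sumx (F : kvert 10 4 -> rat) :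
    \sum_v x v * F v = \sum_(C in P) w C * \sum_(v in C) F v.
  rewrite (eq_bigr (fun v => if v \in ~: S then w (pblock P v) * F v else 0)); last first.
    by move=> v _; rewrite /x; case: ifP; rewrite ?mul0r.
  rewrite -big_mkcond (set_partition_big _ parP); apply: eq_bigr => C CP.
  by rewrite mulr_sumr; apply: eq_bigr => v vC; rewrite (def_pblock trivP CP vC).
have subS C v : C \in P -> v \in C -> v \in ~: S.
  by move=> CP vC; rewrite -covP; apply/bigcupP; exists C.
have xE C v : C \in P -> v \in C -> x v = w C.
  by move=> CP vC; rewrite /x (subS C) // (def_pblock trivP CP vC).
(* An edge leaving [C] ends in [S], where [x] vanishes. *)
have xN C v u : C \in P -> v \in C -> e v u -> x u = w C * indic C u.
  move=> CP vC evu; rewrite /indic; case: (boolP (u \in C)) => [uC|uC].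
    by rewrite (xE C) // mulr1.
  rewrite mulr0 /x; case: ifP => //; rewrite inE => uS.
  by rewrite (component_closed CP vC evu uS) in uC.
have [+ _] := kneser104_form_bounds x.
have -> : \sum_v x v = \sum_(C in P) #|C|%:R ^+ 2 / D C.
  under eq_bigr do rewrite -[x _]mulr1.
  by rewrite sumx; apply: eq_bigr => C _; rewrite sumr_const /w expr2 mulrAC.
have -> : \sum_v x v * nbr_sum x v + 10 * (\sum_v x v * x v) = \sum_(C in P) #|C|%:R ^+ 2 / D C.
  rewrite !sumx mulr_sumr -big_split; apply: eq_bigr => C CP /=.
  have -> : \sum_(v in C) x v = #|C|%:R * w C.
    by rewrite (eq_bigr (fun=> w C)) ?sumr_const ?mulr_natl // => v; apply: xE.
  have -> : \sum_(v in C) nbr_sum x v = w C * (inner_degree e C)%:R.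
    rewrite /inner_degree natr_sum mulr_sumr; apply: eq_bigr => v vC.
    rewrite -nbr_sum_indic /nbr_sum mulr_sumr; apply: eq_bigr => u evu.
    exact: xN evu.
  (* If [D C] is 0, its inverse is 0 by convention and both sides vanish. *)
  have [CP0|] := eqVneq (D C) 0; last by rewrite /w /D => D0; field.
  by rewrite /w CP0 invr0; ring.
have : 0 <= \sum_(C in P) #|C|%:R ^+ 2 / D C.
  by apply: sumr_ge0 => C _; rewrite divr_ge0 ?exprn_ge0 // addr_ge0 ?mulr_ge0.
rewrite -/(D _); move: (\sum_(C in P) _) => t t0 ht; nra.
Qed.

(** * The toughness bound and its equality case *)

Lemma kneser104_cut (S : {set kvert 10 4}) :
  vertex_cut (@kneser_adj 10 4) S ->
  (3 * ncomp (@kneser_adj 10 4) S <= 2 * #|S|)%N /\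
  ((3 * ncomp (@kneser_adj 10 4) S = 2 * #|S|)%N ->
    {in components (@kneser_adj 10 4) S, forall C : {set kvert 10 4}, #|C| = 1%N}).
Proof.
set e := @kneser_adj 10 4; set P := components e S => cutS.
have parP := partition_components S (@kneser_sym 10 4).
pose f (C : {set kvert 10 4}) : rat := (3 + 2 * #|C|%:R) / 50.
pose g (C : {set kvert 10 4}) : rat :=
  #|C|%:R ^+ 2 / ((inner_degree e C)%:R + 10 * #|C|%:R).
have fg : \sum_(C in P) f C <= \sum_(C in P) g C ?= iff [forall (C | C \in P), #|C| == 1%N].
  by apply: leif_sum => C; apply: component_weight.
have gle : \sum_(C in P) g C <= 42 / 5 := sum_component_weight cutS.
have cS : (#|~: S| + #|S| = 210)%N by rewrite addnC cardsC card_kvert.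
have fE : \sum_(C in P) f C = (3 * (ncomp e S)%:R + 2 * #|~: S|%:R) / 50.
  rewrite (card_partition parP) natr_sum -mulr_suml big_split /= -mulr_sumr.
  by rewrite sumr_const mulr_natr.
have cSr : #|~: S|%:R + #|S|%:R = 210 :> rat by rewrite -natrD cS.
have [fle feq] := fg; rewrite fE in fle feq.
move: (\sum_(C in P) g C) gle fle feq => G gle fle feq {fE}.
have cE (m p : nat) : m%:R + #|S|%:R = 210 :> rat ->
    ((3 * p <= 2 * #|S|)%N = (3 * p%:R + 2 * m%:R <= 420 :> rat)) *
    ((3 * p == 2 * #|S|)%N = (3 * p%:R + 2 * m%:R == 420 :> rat)).
  rewrite -(ler_nat rat) -(eqr_nat rat) !natrM.
  move: (m%:R : rat) (p%:R : rat) (#|S|%:R : rat) => m' p' s' ms.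
  by split; [apply/idP/idP => ?; lra | apply/eqP/eqP => ?; lra].
rewrite (cE _ _ cSr).1; split; first by lra.
move/eqP; rewrite (cE _ _ cSr).2 => /eqP e420 C CP; apply/eqP.
(* Equality makes the lower sum 420/50 = 42/5, which squeezes [G] and forces equality in every
   term. *)
suff /forall_inP -> : [forall (C | C \in P), #|C| == 1%N] by [].
by rewrite -feq e420 eq_le -{1}e420 fle; lra.
Qed.

Theorem theorem5p4 :
  is_toughness (@kneser_adj 10 4) (3%:R / 2%:R)%R /\
  (forall S : {set kvert 10 4},
     vertex_cut (@kneser_adj 10 4) S ->
     cut_ratio (@kneser_adj 10 4) S = (3%:R / 2%:R)%R ->
     exists2 I : {set kvert 10 4},
       maximum_independent (@kneser_adj 10 4) I & S = ~: I).
Proof.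
have cS (S : {set kvert 10 4}) : (#|S| + #|~: S| = 210)%N.
  by rewrite cardsC card_kvert.
have ratio_le (S : {set kvert 10 4}) : vertex_cut (@kneser_adj 10 4) S ->
    (3%:R / 2%:R <= cut_ratio (@kneser_adj 10 4) S) /\
    (cut_ratio (@kneser_adj 10 4) S = 3%:R / 2%:R ->
     (3 * ncomp (@kneser_adj 10 4) S = 2 * #|S|)%N).
  move=> cutS; have [le32 _] := kneser104_cut cutS.
  have c0 : 0 < (ncomp (@kneser_adj 10 4) S)%:R :> rat.
    by rewrite ltr0n; apply: ltn_trans cutS.
  split.
    rewrite /cut_ratio (ler_pdivlMr _ _ c0).
    by move: le32; rewrite -(ler_nat rat) !natrM; lra.
  move=> /(congr1 (fun t => t * (ncomp (@kneser_adj 10 4) S)%:R)).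
  rewrite /cut_ratio divfK ?gt_eqF // => e.
  by apply/eqP; rewrite -(eqr_nat rat) !natrM; apply/eqP; lra.
split; last first.
  move=> S cutS /(ratio_le S cutS).2 e3; have [_ /(_ e3) all1] := kneser104_cut cutS.
  exists (~: S); last by rewrite setCK.
  have ncE : ncomp (@kneser_adj 10 4) S = #|~: S|.
    rewrite (card_partition (partition_components S (@kneser_sym 10 4))).
    by rewrite (eq_bigr (fun=> 1%N)) ?sum1_card.
  split.
    apply/forall_inP => A; rewrite inE => AS; apply/forall_inP => B; rewrite inE => BS.
    apply/negP => eAB.
    have CP : comp_of (@kneser_adj 10 4) S A \in components (@kneser_adj 10 4) S.
      by apply: imset_f; rewrite inE.
    have AC := comp_refl (@kneser_adj 10 4) AS.
    have BC := component_closed CP AC eAB BS.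
    have /eqP/cards1P[D DE] := all1 _ CP.
    move: AC BC; rewrite DE !inE => /eqP AD /eqP BD.
    by rewrite AD BD kneser_irr in eAB.
  (* From [3 c = 2 |S|] and [c + |S| = 210] follows [c = 84], the independence bound. *)
  move=> J /kneser104_independent_le J84; move: (cS S) e3 J84; rewrite -ncE.
  move: #|S| (ncomp _ _) #|J| => a b c; clear; lia.
split; last by move=> S /ratio_le[].
(* The extremal cut is the complement of a star: the 'C(9, 3) = 84 sets through one point are
   pairwise intersecting, and 126/84 = 3/2. *)
pose I := [set A : kvert 10 4 | ord0 \in val A].
have indI : independent (@kneser_adj 10 4) I.
  apply/forall_inP => A; rewrite inE => A0; apply/forall_inP => B; rewrite inE => B0.
  by apply/negP => /disjointFr/(_ A0); rewrite B0.
have cI : #|I| = 84%N.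
  have := @card_kvert_set 10 4 (fun C => ord0 \in C); rewrite -/I => ->.
  have := @card_draws_meet _ [set ord0 : 'I_10] [set: 'I_10] 4 1 isT.
  rewrite setTI cards1 setTD cardsC1 card_ord => e.
  rewrite -[RHS]e; congr #|pred_of_set _|; apply/setP => C.
  rewrite !inE subsetT andbC /=; congr (_ && _).
  case: (boolP (ord0 \in C)) => C0; first by rewrite (setIidPr _) ?sub1set // cards1.
  rewrite (_ : C :&: _ = set0) ?cards0 //.
  by apply/eqP; rewrite setI_eq0 disjoint_sym disjoints1.
exists (~: I); first by rewrite /vertex_cut ncomp_independent // cI.
rewrite /cut_ratio ncomp_independent // cI.
have -> : #|~: I| = 126%N by rewrite cardsCs setCK cI card_kvert.
by apply/eqP.
Qed.
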